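(* For every integer $n\geq 3$, \[ c_5(n)=\frac{L^*_3(n;\sigma_5)}{2}-\sum_{i=2}^{n-1}i\cdot\Lambda(n,i), \] where $\sigma_5=++-$.
   Context: $\mathcal S_n$ is the set of permutations of $[n]$ in one-line notation $\pi=\pi_1\cdots\pi_n$; $\mathcal C_n$ is the set of cyclic permutations (single $n$-cycle) in $\mathcal S_n$. For $\sigma=\sigma^0\cdots\sigma^{k-1}\in\{+,-\}^k$, $\mathcal S^\sigma_n$ is the set of $\pi\in\mathcal S_n$ for which there exist $0=e_0\le e_1\le\cdots\le e_k=n$ with each segment $\pi_{e_i+1}\cdots\pi_{e_{i+1}}$ increasing if $\sigma^i=+$ and decreasing if $\sigma^i=-$; $\mathcal C_n^\sigma=\mathcal C_n\cap\mathcal S_n^\sigma$. $c_5(n)=|\mathcal C_n^{++-}|$. $\Lambda(n,i)$ is the number of $\pi\in\mathcal C_n^{+-}$ (cyclic unimodal permutations) with $\pi_i=n$. A word of length $m$ on $k$ letters is $s=s_1\cdots s_m$ with $s_j\in\{0,\dots,k-1\}$; primitive means not of the form $q^r$ with $r>1$. Necklaces are rotation classes of words, primitive if their representatives are. $L_k(m)$ is the number of primitive necklaces of length $m$ on $k$ letters. With $T_\sigma^-=\{i:\sigma^i=-\}$ and $o_\sigma(s)=|\{j:s_j\in T_\sigma^-\}|$, $L_k(m;\sigma)$ is the number of primitive necklaces of length $m$ on $k$ letters with $o_\sigma(s)$ odd ($0$ if $m$ is not an integer), and $L_k^*(n;\sigma)=L_k(n)+L_k(\tfrac n2;\sigma)$.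 *)

(* Defs.v *)
From mathcomp Require Import all_boot all_order all_algebra all_fingroup.
Set Implicit Arguments. Unset Strict Implicit. Unset Printing Implicit Defensive.

(* Conventions: [n] = {1..n} is represented by 'I_n = {0..n-1} via x |-> x+1.
   A permutation pi : 'S_n has one-line notation pi_1 ... pi_n where
   pi_i = val (pi (i-1)) + 1.  The shift by one preserves monotonicity
   and cycle structure.  A sign pattern sigma in {+,-}^k is a seq bool,
   with true = '+' and false = '-'. *)

(* one-line notation (values shifted down by 1) *)
Definition oneline (n : nat) (pi : 'S_n) : seq nat := [seq val (pi i) | i <- enum 'I_n].

Definition monseg (b : bool) (s : seq nat) : bool :=
  if b then sorted ltn s else sorted gtn s.

(* s splits as s = s_0 ++ ... ++ s_{k-1} (possibly empty segments), each s_i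
   monotone according to sigma^i; equivalently breakpoints 0=e_0<=...<=e_k=|s| *)
Fixpoint in_pattern (sigma : seq bool) (s : seq nat) : bool :=
  match sigma with
  | [::] => s == [::]
  | b :: sigma' =>
      [exists j : 'I_(size s).+1, monseg b (take j s) && in_pattern sigma' (drop j s)]
  end.

Definition cyclicp (n : nat) (pi : 'S_n) : bool := #|porbits pi| == 1.

Definition Csigma (n : nat) (sigma : seq bool) : {set 'S_n} :=
  [set pi : 'S_n | cyclicp pi && in_pattern sigma (oneline pi)].

Definition sigma5 : seq bool := [:: true; true; false].

Definition c5 (n : nat) : nat := #|Csigma n sigma5|.

Definition Lambda (n i : nat) : nat :=
  #|[set pi in Csigma n [:: true; false] |
      [exists j : 'I_n, (j.+1 == i) && (val (pi j) == n.-1)]]|.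

Definition primitive_word (k m : nat) (w : m.-tuple 'I_k) : bool :=
  ~~ [exists r : 'I_m.+1,
        [&& 1 < r, r %| m & val w == flatten (nseq r (take (m %/ r) w))]].

Definition necklace (k m : nat) (w : m.-tuple 'I_k) : {set m.-tuple 'I_k} :=
  [set rot_tuple j w | j : 'I_m.+1].

Definition Lneck (k m : nat) : nat :=
  #|[set necklace w | w : m.-tuple 'I_k & primitive_word w]|.

Definition o_sigma (sigma : seq bool) (k m : nat) (w : m.-tuple 'I_k) : nat :=
  count (fun a : 'I_k => ~~ nth true sigma a) w.

(* L_k(m;sigma): primitive necklaces with o_sigma odd (o_sigma is rotation-invariant) *)
Definition Lneck_sig (k m : nat) (sigma : seq bool) : nat :=
  #|[set necklace w | w : m.-tuple 'I_k & primitive_word w && odd (o_sigma sigma w)]|.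

Definition Lstar (k n : nat) (sigma : seq bool) : nat :=
  Lneck k n + (if odd n then 0 else Lneck_sig k n./2 sigma).

(* Main.v *)
Require Import Defs.
From mathcomp Require Import all_boot all_order all_algebra all_fingroup zify.
Set Implicit Arguments. Unset Strict Implicit. Unset Printing Implicit Defensive.

(* Read a sigma-segmentation of pi as a nondecreasing labeling l of the positions
   by letters.  A cyclic pi with a segmentation and a base point j has the
   itinerary word w_i = l(pi^i(j)); writing P_i = pi^i(j), the order O of the P_i
   on Z/n is a fixed point of the operator F_w which compares first letters and,
   at equal letters, pulls O back along the shift, reversing it on '-' letters.
   Conversely every F_w-invariant total order comes from such data.  If w is
   primitive, F_w^n is constant, so there is exactly one fixed point.  If w = qq
   with q primitive of length d and an odd number of '-', F_w^d only remembers
   how each pair {i, i + d} is ordered, which leaves two fixed points, exchanged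
   by the shift by d.  In all other cases w has a proper period carrying an even
   number of '-', along which P would be strictly monotone.  Dividing by the n
   base points, Lstar counts pairs (cyclic pi, segmentation).
   For ++-, a cyclic unimodal pi with peak at position i has 2i + 2
   segmentations, and any other pi of the class has exactly 2. *)

(** * Signed lexicographic comparison along a word *)

Section SignedOrder.

Variables (sg : nat -> bool) (W : nat -> nat).

(* The operator of the header, iterated [k] times; [sg a] is true on '+' letters. *)
Fixpoint pullback (k : nat) (O : rel nat) (i j : nat) : bool :=
  if k is k'.+1 then
    (W i < W j) || (W i == W j) &&
      (if sg (W i) then pullback k' O i.+1 j.+1 else pullback k' O j.+1 i.+1)
  else O i j.

(** Parity of the number of '-' letters among the [k] letters from position [i] on. *)
Fixpoint flips (k i : nat) : bool :=
  if k is k'.+1 then ~~ sg (W i) (+) flips k' i.+1 else false.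

Definition periodic (d : nat) := forall i, W (i + d) = W i.

Definition key_rel (f : nat -> nat) : rel nat := fun i j => f i < f j.

Definition compat (P : nat -> nat) :=
  forall i j, key_rel P i j = pullback 1 (key_rel P) i j.

Lemma eq_pullback k O O' i j : O =2 O' -> pullback k O i j = pullback k O' i j.
Proof. by move=> eqO; elim: k i j => [|k IH] i j /=; rewrite ?IH ?eqO. Qed.

Lemma pullbackS k O i j : pullback k.+1 O i j = pullback k (pullback 1 O) i j.
Proof.
elim: k i j => [|k IH] i j //.
rewrite -[LHS]/((W i < W j) || (W i == W j) &&
   (if sg (W i) then pullback k.+1 O i.+1 j.+1 else pullback k.+1 O j.+1 i.+1)).
by rewrite !IH.
Qed.

Lemma compat_pullback P k i j : compat P -> key_rel P i j = pullback k (key_rel P) i j.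
Proof.
move=> cP; elim: k i j => [|k IH] i j //.
by rewrite pullbackS IH; apply: eq_pullback => {}i {}j; apply: cP.
Qed.

(** The first differing letter decides the comparison before the recursion ever consults [O]. *)
Lemma pullback_diff k O O' i j t :
  t < k -> W (i + t) != W (j + t) -> pullback k O i j = pullback k O' i j.
Proof.
elim: k i j t => [|k IH] i j [|t] //= ltk neqW.
  by move: neqW; rewrite !addn0 => /negPf ->.
case: ifP => _; congr (_ || (_ && _)).
- by apply: (IH _ _ t) => //; rewrite !addSnnS.
- by apply: (IH _ _ t) => //; rewrite !addSnnS eq_sym.
Qed.

(** Equal letters decide nothing and each '-' swaps the two arguments, so only the parity of the
    swaps survives. *)
Lemma pullback_same k O i j : (forall t, t < k -> W (i + t) = W (j + t)) ->
  pullback k O i j = if flips k i then O (j + k) (i + k) else O (i + k) (j + k).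
Proof.
elim: k i j => [|k IH] i j eqW; first by rewrite /= !addn0.
have eq0 : W i = W j by have := eqW 0 isT; rewrite !addn0.
have eqS t : t < k -> W (i.+1 + t) = W (j.+1 + t) by rewrite !addSnnS => ?; apply: eqW.
rewrite /= eq0 ltnn eqxx /= (IH _ _ eqS) (IH j.+1 i.+1) => [|t /eqS//].
have eqf : forall k i j, (forall t, t < k -> W (i + t) = W (j + t)) -> flips k i = flips k j.
  elim=> [|k' IH'] a b eqab //=; have := eqab 0 isT; rewrite !addn0 => ->.
  by congr (_ (+) _); apply: IH' => t ltk; rewrite !addSnnS; apply: eqab.
rewrite -(eqf _ _ _ eqS) !addSnnS.
by case: (sg _); case: (flips _ _).
Qed.

Lemma flipsD k l i : flips (k + l) i = flips k i (+) flips l (i + k).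
Proof. by elim: k i => [|k IH] i; rewrite ?addn0 //= IH addSnnS addbA. Qed.

Lemma flipsS k i : flips k.+1 i = flips k i (+) ~~ sg (W (i + k)).
Proof. by rewrite -addn1 flipsD /= addbF. Qed.

Lemma periodicM d c i : periodic d -> W (i + d * c) = W i.
Proof.
by move=> pd; elim: c => [|c IH]; rewrite ?muln0 ?addn0 // mulnS addnCA addnC pd.
Qed.

Lemma periodic_mod d i j : periodic d -> i = j %[mod d] -> W i = W j.
Proof.
move=> pd eqij; rewrite (divn_eq i d) (divn_eq j d) eqij.
by rewrite ![_ * d + _]addnC ![_ * d]mulnC !periodicM.
Qed.

(** Sliding a window of one period by one position drops a letter and gains the same letter back. *)
Lemma flips_periodic d i : periodic d -> flips d i = flips d 0.
Proof.
move=> pd; elim: i => // i <-.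
have := flipsS d i; rewrite pd /=.
by case: (sg _); case: (flips d i); case: (flips d i.+1).
Qed.

Lemma flips_periodicM d c i : periodic d -> flips (d * c) i = odd c && flips d 0.
Proof.
move=> pd; elim: c i => [|c IH] i; first by rewrite muln0.
by rewrite mulnS flipsD IH flips_periodic //=; case: (odd c); case: (flips d 0).
Qed.

(** Two equal windows of length [d] make [j - i] a period of the whole word, hence a multiple of the
    minimal one. *)
Lemma window_eq d i j : 0 < d -> periodic d ->
    (forall e, periodic e -> d %| e) ->
  (forall t, t < d -> W (i + t) = W (j + t)) -> i = j %[mod d].
Proof.
move=> d0 pd prim.
wlog leij : i j / i <= j.
  move=> H; case: (leqP i j) => [|/ltnW] le eqW; first exact: H.
  by apply/esym/H => // t lt; rewrite eqW.
move=> eqW; apply/esym/eqP; rewrite eqn_mod_dvd //; apply: prim => s.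
(* This is the residue of [s - i], since [i * d.-1] stands for [- i] modulo [d]. *)
set t := (s + i * d.-1) %% d.
have h1 : s = i + t %[mod d].
  by rewrite /t modnDmr addnCA addnC -mulnS prednK // modnMDl.
have h2 : s + (j - i) = j + t %[mod d].
  rewrite -modnDml h1 modnDml; congr (_ %% _); lia.
by rewrite (periodic_mod pd h1) (periodic_mod pd h2) eqW // ltn_mod.
Qed.

End SignedOrder.

(** * Total orders on residues modulo n and their rank functions *)

Section Rankings.

Variables (sg : nat -> bool) (W : nat -> nat) (n : nat).
Hypotheses (n_gt0 : 0 < n) (pW : periodic W n).

Definition inj_mod (f : nat -> nat) :=
  forall i j, (f i == f j) = (i == j %[mod n]).

(* [O] is a strict total order on residues modulo [n], given by a bounded key. *)
Definition keyed (O : rel nat) :=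
  exists f N, [/\ forall i, f i < N, inj_mod f & O =2 key_rel f].

Lemma keyed_irr O i j : keyed O -> i = j %[mod n] -> O i j = false.
Proof.
case=> f [N [_ injf eqO]] /eqP eqij; rewrite eqO /key_rel.
by move: eqij; rewrite -injf => /eqP ->; rewrite ltnn.
Qed.

Lemma keyed_pullback1 O : keyed O -> keyed (pullback sg W 1 O).
Proof.
case=> f [N [ltf injf eqO]].
(* A lexicographic key in base [N]: the letter first, then the key of the successor, complemented on
   '-' letters. *)
pose g i := W i * N + if sg (W i) then f i.+1 else N.-1 - f i.+1.
pose M := (\max_(i < n) W i).+1 * N.
have leW i : W i <= \max_(i < n) W i.
  rewrite (@periodic_mod W n i (i %% n)) ?modn_mod //.
  by apply: (leq_bigmax (Ordinal (ltn_pmod i n_gt0))).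
have ltr i : (if sg (W i) then f i.+1 else N.-1 - f i.+1) < N.
  by case: ifP => _; have := ltf i.+1; lia.
have eqg i j : pullback sg W 1 O i j = (g i < g j).
  rewrite /= !eqO /key_rel /g; have := ltr i; have := ltr j.
  case: (ltngtP (W i) (W j)) => [ltW|ltW|->] /=; try nia.
  case: (sg _); rewrite ltn_add2l //.
  by have := ltf i.+1; have := ltf j.+1; lia.
exists g, M; split=> [i|i j|//].
  rewrite /g /M mulSn addnC; have := ltr i; have := leW i; nia.
apply/eqP/eqP=> [eqij|eqij].
  have := eqg i j; have := eqg j i; rewrite eqij ltnn /=.
  case: ltngtP => //= eqW; rewrite -eqW !eqO /key_rel => hji hij.
  have : f i.+1 == f j.+1 by case: (sg _) hji hij; case: ltngtP.
  by rewrite injf -addn1 -(addn1 j) eqn_modDr => /eqP.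
have eqW := periodic_mod pW eqij.
have /eqP eqf : f i.+1 == f j.+1 by rewrite injf -addn1 -(addn1 j) eqn_modDr; apply/eqP.
by rewrite /g eqW eqf.
Qed.

Lemma keyed_pullback k O : keyed O -> keyed (pullback sg W k O).
Proof. by elim: k => // k IH kO; apply: (keyed_pullback1 (IH kO)). Qed.

Definition ranking (P : nat -> nat) := (forall i, P i < n) /\ inj_mod P.

(** The rank of [i] is the number of residues with a smaller key; it stays below [n] because no
    residue lies below itself. *)
Lemma ranking_exists O : keyed O -> exists2 P, ranking P & O =2 key_rel P.
Proof.
case=> f [N [_ injf eqO]].
pose P i := #|[pred j : 'I_n | f j < f i]|.
have fmod i : f (i %% n) = f i by apply/eqP; rewrite injf modn_mod.
have mono i j : f i <= f j -> P i <= P j.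
  by move=> le; apply: subset_leq_card; apply/subsetP=> x; rewrite !inE => /leq_trans; apply.
have lt i j : f i < f j -> P i < P j.
  move=> ltij; apply: proper_card; apply/properP; split.
    by apply/subsetP=> x; rewrite !inE => /ltn_trans; apply.
  by exists (Ordinal (ltn_pmod i n_gt0)); rewrite !inE /= fmod ?ltnn.
have ltE i j : (P i < P j) = (f i < f j).
  by apply/idP/idP => [|/lt//]; apply: contraTT; rewrite -!leqNgt => /mono.
exists P => [|i j]; last by rewrite eqO /key_rel ltE.
split=> [i|i j]; last first.
  rewrite -injf; apply/eqP/eqP=> [eqR|eqf]; last by apply/eqP; rewrite eqn_leq !mono ?eqf.
  by have := ltE i j; have := ltE j i; rewrite eqR ltnn; case: ltngtP.
rewrite -[X in _ < X](card_ord n); apply: proper_card; apply/properP; split.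
  by apply/subsetP.
by exists (Ordinal (ltn_pmod i n_gt0)); rewrite ?inE //= fmod ltnn.
Qed.

(** A ranking is a bijection from residues to 0..n-1, so it can be recovered from the order it
    induces. *)
Lemma ranking_rank P i : ranking P -> P i = #|[pred j : 'I_n | P j < P i]|.
Proof.
case=> ltP injP.
pose p (j : 'I_n) := Ordinal (ltP j).
have injp : injective p.
  move=> a b /(congr1 val)/= /eqP; rewrite injP !modn_small // => /eqP eqab.
  exact: val_inj.
rewrite -[LHS]/(val (Ordinal (ltP i))).
set y := Ordinal (ltP i).
have -> : #|[pred j : 'I_n | P j < P i]| = #|[pred x : 'I_n | x < y]|.
  rewrite -[RHS](card_imset _ (@perm_inj _ (perm injp)^-1%g)).
  apply: eq_card => j; rewrite inE; apply/idP/imsetP => [ltj|[x + ->]].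
    by exists (perm injp j); rewrite ?permK // inE permE.
  by rewrite inE /= => ltx; rewrite -[X in X < _]/(val (p _)) -(permE injp) permKV.
rewrite -sum1_card -(big_ord_widen n (fun=> 1) (ltnW (ltn_ord y))).
by rewrite sum1_card card_ord.
Qed.

Lemma ranking_eq P P' : ranking P -> ranking P' -> key_rel P =2 key_rel P' -> P =1 P'.
Proof.
move=> rP rP' eqK i; rewrite (ranking_rank i rP) (ranking_rank i rP').
by apply: eq_card => j; rewrite !inE; apply: eqK.
Qed.

(** If [k] steps of the operator erase the difference between a seed order and its image, the [k]-th
    iterate of the seed is a fixed point. *)
Lemma compat_exists k f : inj_mod f -> (exists N, forall i, f i < N) ->
    pullback sg W k (pullback sg W 1 (key_rel f)) =2 pullback sg W k (key_rel f) ->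
  exists2 P, ranking P & compat sg W P.
Proof.
move=> injf [N ltf] fixf.
have [|P rP eqR] := @ranking_exists (pullback sg W k (key_rel f)).
  by apply: keyed_pullback; exists f, N; split.
exists P => // i j; rewrite -eqR -fixf -pullbackS.
rewrite -[LHS]/(pullback sg W 1 (pullback sg W k (key_rel f)) i j).
by apply: eq_pullback.
Qed.

End Rankings.

(** * Existence and uniqueness of fixed points *)

Section Solutions.

Variables (sg : nat -> bool) (W : nat -> nat).

Definition primitive_period (d : nat) :=
  periodic W d /\ forall e, periodic W e -> d %| e.

Lemma window_diff d i j : 0 < d -> primitive_period d -> i != j %[mod d] ->
  exists2 t, t < d & W (i + t) != W (j + t).
Proof.
move=> d0 [pd prim] neq.
have [/existsP[t ht]|] := boolP [exists t : 'I_d, W (i + t) != W (j + t)]; first by exists t.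
rewrite negb_exists => /forallP eqW; case/eqP: neq.
apply: (window_eq d0 pd prim) => t lt.
by apply/eqP; have := eqW (Ordinal lt); rewrite negbK.
Qed.

(** Any seed works, here the order of remainders: distinct residues are separated within [n]
    letters, so the [n]-th iterate forgets the seed. *)
Lemma compat_exists_primitive n : 0 < n -> primitive_period n ->
  exists2 P, ranking n P & compat sg W P.
Proof.
move=> n0 prim; have [pW _] := prim.
have injf : inj_mod n (modn^~ n) by [].
have kf : keyed n (key_rel (modn^~ n)).
  by exists (modn^~ n), n; split=> // i; rewrite ltn_mod.
apply: (compat_exists (k := n) n0 pW injf) => [|i j].
  by exists n => i; rewrite ltn_mod.
have [/eqP eqij|] := boolP (i == j %[mod n]); last first.
  by case/(window_diff n0 prim) => t; apply: pullback_diff.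
rewrite !(keyed_irr _ eqij) //; apply: keyed_pullback => //.
exact: keyed_pullback1.
Qed.

(** Both orders equal their own [n]-th pullbacks, and these agree on every pair of distinct
    residues. *)
Lemma compat_unique_primitive n P P' : 0 < n -> primitive_period n ->
  ranking n P -> ranking n P' -> compat sg W P -> compat sg W P' -> P =1 P'.
Proof.
move=> n0 prim rP rP' cP cP'; apply: (ranking_eq (n := n)) => // i j.
have [eqij|] := boolP (i == j %[mod n]); last first.
  case/(window_diff n0 prim) => t lt neq.
  rewrite (compat_pullback n i j cP) (compat_pullback n i j cP').
  exact: pullback_diff lt neq.
have [[_ injP] [_ injP']] := (rP, rP').
by move: (eqij) (eqij); rewrite -{1}injP -injP' /key_rel => /eqP-> /eqP->; rewrite !ltnn.
Qed.

Lemma mod_double d i j : 0 < d -> i = j %[mod d] ->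
  i != j %[mod d + d] -> j = i + d %[mod d + d].
Proof.
move=> d0 eqd /eqP neq.
have ndvd x : x %% (d + d) = x %% d \/ x %% (d + d) = x %% d + d.
  have := ltn_pmod x (_ : 0 < d + d); rewrite addn_gt0 d0 => /(_ isT) lt.
  have -> : x %% d = (x %% (d + d)) %% d.
    by rewrite modn_dvdm // addnn -mul2n dvdn_mull.
  move: (x %% (d + d)) lt => r lt.
  case: (ltnP r d) => le; first by left; rewrite (modn_small le).
  right; have -> : r %% d = r - d by rewrite -{1}(subnK le) modnDr modn_small //; lia.
  lia.
have hd : 0 < d + d by lia.
have h r : r < d + d -> (r + d) %% (d + d) = if r < d then r + d else r - d.
  move=> lt; case: ltnP => le; first by rewrite modn_small // ltn_add2r.
  by rewrite -{1}(subnK le) -addnA modnDr modn_small //; lia.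
rewrite -modnDml h ?ltn_mod //.
have := ltn_pmod i d0; have := ltn_pmod j d0.
have := ndvd i; have := ndvd j; move: neq; rewrite eqd.
move: (i %% (d + d)) (j %% (d + d)) (j %% d) => a b c; case: (ltnP a d); lia.
Qed.

(** * Words whose minimal period is n/2 and carries an odd number of '-' *)

Section Double.

Variable d : nat.
Hypotheses (d_gt0 : 0 < d) (prim : primitive_period d) (oddW : flips sg W d 0).

Let n := d + d.
Let pd : periodic W d. Proof. by case: prim. Qed.
Let pn : periodic W n. Proof. by move=> i; rewrite addnA !pd. Qed.

(** The two halves of a stretch of length [n] have the same parity, so together they contribute
    nothing. *)
Lemma flips_mod i j : i = j %[mod n] -> flips sg W i 0 = flips sg W j 0.
Proof.
have red x : flips sg W x 0 = flips sg W (x %% n) 0.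
  rewrite {1}(divn_eq x n) addnC flipsD mulnC flips_periodicM //.
  by rewrite [flips sg W n 0]flipsD (flips_periodic _ (0 + d) pd) addbb andbF addbF.
by move=> eqij; rewrite red eqij -red.
Qed.

Lemma flips_shift i : flips sg W (i + d) 0 = ~~ flips sg W i 0.
Proof. by rewrite flipsD flips_periodic // oddW addbT. Qed.

Lemma compat_exists_double : exists2 P, ranking n P & compat sg W P.
Proof.
have n0 : 0 < n by rewrite /n; lia.
(* The pairs {i, i + d}, which the word does not separate, are ordered by the
   parity of the '-' letters before i: F preserves this choice. *)
pose f i := flips sg W i 0 * n + i %% n.
have injf : inj_mod n f.
  move=> i j; apply/eqP/eqP => [|eqij]; last by rewrite /f (flips_mod eqij) eqij.
  by move/(congr1 (modn^~ n)); rewrite /f /= !modnMDl !modn_mod.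
have ltf i : f i < n + n by rewrite /f; have := ltn_pmod i n0; case: flips; lia.
have kf : keyed n (key_rel f) by exists f, (n + n); split.
apply: (compat_exists (k := d) n0 pn injf) => [|i j]; first by exists (n + n).
have [/eqP eqd|] := boolP (i == j %[mod d]); last first.
  by case/(window_diff d_gt0 prim) => t; apply: pullback_diff.
have [/eqP eqij|neqij] := boolP (i == j %[mod n]).
  rewrite !(keyed_irr _ eqij) //; apply: keyed_pullback => //.
  exact: keyed_pullback1.
have same t : t < d -> W (i + t) = W (j + t).
  by move=> _; apply: (periodic_mod pd); rewrite -modnDml eqd modnDml.
rewrite !(pullback_same _ _ same) flips_periodic // oddW.
have ff : flips sg W j 0 = ~~ flips sg W i 0.
  by rewrite -flips_shift; apply: flips_mod; apply: mod_double.
have eqWij : W j = W i by apply: periodic_mod pd _; rewrite eqd.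
(* When the prefix parities differ, the key compares them alone. A step to the successors toggles
   both exactly on a '-' letter, which matches the reversal in the operator. *)
have ltE a b : flips sg W b 0 = ~~ flips sg W a 0 -> key_rel f a b = flips sg W b 0.
  rewrite /key_rel /f => ->; have := ltn_pmod a n0; have := ltn_pmod b n0.
  by case: flips => /=; lia.
rewrite [LHS]/= !pd eqWij ltnn eqxx /= !ltE ?flips_shift ?ff ?negbK //;
  rewrite -?addSn ?flips_shift !flipsS /= ?add0n eqWij ff.
all: by case: (sg _); case: (flips _ _ _ _).
Qed.

(** Words separate all pairs except {i, i + d}, and [i] pullback steps carry the order of such a
    pair to that of {0, d}. *)
Lemma compat_unique_double P P' :
  ranking n P -> ranking n P' -> compat sg W P -> compat sg W P' ->
  (P 0 < P d) = (P' 0 < P' d) -> P =1 P'.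
Proof.
move=> rP rP' cP cP' eq0; apply: (ranking_eq (n := n)) => // i j.
have [[_ injP] [_ injP']] := (rP, rP').
have [/eqP eqd|] := boolP (i == j %[mod d]); last first.
  case/(window_diff d_gt0 prim) => t lt neq.
  rewrite (compat_pullback d i j cP) (compat_pullback d i j cP').
  exact: pullback_diff lt neq.
have [eqij|neqij] := boolP (i == j %[mod n]).
  by move: (eqij) (eqij); rewrite -{1}injP -injP' /key_rel => /eqP-> /eqP->; rewrite !ltnn.
have /eqP ej := mod_double d_gt0 eqd neqij.
have eP : P j = P (i + d) by apply/eqP; rewrite injP.
have eP' : P' j = P' (i + d) by apply/eqP; rewrite injP'.
rewrite /key_rel eP eP'.
have same t : t < i -> W (0 + t) = W (d + t) by rewrite [d + t]addnC pd.
have neq Q : inj_mod n Q -> Q i != Q (i + d).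
  by move=> ->; rewrite -{1}[i]addn0 eqn_modDl mod0n eq_sym modn_small; rewrite /n; lia.
have := compat_pullback i 0 d cP; have := compat_pullback i 0 d cP'.
rewrite !(pullback_same _ _ same) /key_rel eq0 add0n [d + i]addnC => ->.
by have := neq _ injP; have := neq _ injP'; case: flips => //; lia.
Qed.

End Double.

(* Otherwise P would be strictly monotone along 0, d, 2d, ..., nd. *)
Lemma compat_even_period n P d : 0 < n -> ranking n P -> compat sg W P -> periodic W d ->
  ~~ flips sg W d 0 -> n %| d.
Proof.
move=> n0 [_ injP] cP pd /negbTE ev.
(* Even parity makes comparisons invariant under shifts by whole periods, so the first inequality
   propagates until [n * d] returns to 0. *)
have step c a b : P (c * d + a * d) < P (c * d + b * d) = (P (a * d) < P (b * d)).
  have := @compat_pullback sg W P (c * d) (a * d) (b * d) cP.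
  rewrite pullback_same => [|t _].
    by rewrite /key_rel {1}[c * d]mulnC flips_periodicM // ev andbF ![_ + c * d]addnC.
  by apply: (periodic_mod pd); rewrite !modnMDl.
have eq0 : P (n * d) = P 0 by apply/eqP; rewrite injP modnMr mod0n.
have [lt|gt|/eqP] := ltngtP (P 0) (P d); last first.
- by rewrite injP mod0n eq_sym.
- suff: P (n * d) < P 0 by rewrite eq0 ltnn.
  elim: n n0 {injP eq0} => // [[|m]] IH _; first by rewrite mul1n.
  apply: ltn_trans (IH isT).
  by have := step m.+1 1 0; rewrite mul1n mul0n gt addn0 mulSn addnC => ->.
- suff: P 0 < P (n * d) by rewrite eq0 ltnn.
  elim: n n0 {injP eq0} => // [[|m]] IH _; first by rewrite mul1n.
  apply: (ltn_trans (IH isT)).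
  by have := step m.+1 0 1; rewrite mul1n mul0n lt addn0 [m.+2 * _]mulSn addnC => ->.
Qed.

End Solutions.

(** * Periodic words, primitivity and necklaces *)

Lemma nth_flatten_nseq (T : Type) (x : T) r (q : seq T) i : i < r * size q ->
  nth x (flatten (nseq r q)) i = nth x q (i %% size q).
Proof.
elim: r i => [|r IH] i //=; rewrite mulSn nth_cat => lt.
case: ltnP => [lti|le]; first by rewrite modn_small.
rewrite IH; last by lia.
by rewrite -[in RHS](subnK le) modnDr.
Qed.

Lemma size_flatten_nseq (T : Type) r (q : seq T) : size (flatten (nseq r q)) = r * size q.
Proof. by elim: r => [|r IH] //=; rewrite size_cat IH mulSn. Qed.

Lemma map_flatten_nseq (T U : Type) (f : T -> U) r q :
  map f (flatten (nseq r q)) = flatten (nseq r (map f q)).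
Proof. by rewrite map_flatten map_nseq. Qed.

(** By Bezout, the gcd is the difference of a multiple of [d] and a multiple of [e]. *)
Lemma periodic_gcd (W : nat -> nat) d e : 0 < d ->
  periodic W d -> periodic W e -> periodic W (gcdn d e).
Proof.
move=> d0 pd pe i; case: (egcdnP e d0) => a b E _.
have <- : W (i + gcdn d e + e * b) = W (i + gcdn d e) by rewrite periodicM.
by rewrite -addnA [e * b]mulnC [_ + b * e]addnC -E mulnC periodicM.
Qed.

Lemma flips_odd_count (sg : nat -> bool) W l i :
  flips sg W l i = odd (count (fun a => ~~ sg a) [seq W j | j <- iota i l]).
Proof. by elim: l i => //= l IH i; rewrite oddD IH; case: (sg _). Qed.

Section Words.

Variables (k m : nat).
Hypothesis m_gt0 : 0 < m.
Implicit Types (w : m.-tuple 'I_k) (sigma : seq bool).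

(** The periodic extension of the word; for positive [m] the default 0 is never reached. *)
Definition letters w (i : nat) : nat := nth 0 (map val w) (i %% m).

Lemma letters_periodic w : periodic (letters w) m.
Proof. by move=> i; rewrite /letters modnDr. Qed.

Lemma letters_nth w i : i < m -> letters w i = nth 0 (map val w) i.
Proof. by move=> lt; rewrite /letters modn_small. Qed.

Lemma letters_inj w w' : letters w =1 letters w' -> w = w'.
Proof.
move=> eqw; apply/val_inj/(inj_map val_inj)/(@eq_from_nth _ 0).
  by rewrite !size_map !size_tuple.
by move=> i; rewrite size_map size_tuple => lt; rewrite -!letters_nth.
Qed.

Lemma letters_rot w j i : j <= m -> letters (rot_tuple j w) i = letters w (i + j).
Proof.
move=> lejm; rewrite /letters map_rot /rot nth_cat nth_drop size_drop.
rewrite size_map size_tuple.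
have := ltn_pmod i m_gt0; rewrite -modnDml; move: (i %% m) => {}i lti.
case: ltnP => [lt|le]; first by rewrite addnC modn_small //; lia.
rewrite nth_take; last by lia.
have -> : i + j = (i - (m - j)) + m by lia.
by rewrite modnDr modn_small //; lia.
Qed.

(** The gcd of [m] and any period is again a period and divides [m]; if it were proper, the word
    would be a power. Conversely, an [r]-th power has the period [m %/ r]. *)
Lemma primitive_wordP w : reflect (primitive_period (letters w) m) (primitive_word w).
Proof.
apply: (iffP idP) => [prim|[_ prim]].
  split=> [|d pd]; first exact: letters_periodic.
  have [->|d0] := posnP d; first exact: dvdn0.
  have pg := periodic_gcd m_gt0 (letters_periodic w) pd.
  set g := gcdn m d in pg; have gm : g %| m := dvdn_gcdl m d.
  have g0 : 0 < g by rewrite gcdn_gt0 m_gt0.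
  suff <- : g = m by exact: dvdn_gcdr.
  apply/eqP; apply: contraNT prim => neq.
  have leg := dvdn_leq m_gt0 gm.
  have ltr : m %/ g < m.+1 by rewrite ltnS leq_div.
  apply/existsP; exists (Ordinal ltr) => /=; apply/and3P; split.
  - rewrite ltn_divRL //; lia.
  - exact: dvdn_div.
  have -> : m %/ (m %/ g) = g by rewrite divnA // mulKn.
  have szq : size (map val (take g w)) = g by rewrite size_map size_takel // size_tuple.
  apply/eqP/(inj_map val_inj)/(@eq_from_nth _ 0).
    by rewrite map_flatten_nseq size_flatten_nseq szq divnK // size_map size_tuple.
  rewrite size_map size_tuple => i lti.
  rewrite map_flatten_nseq nth_flatten_nseq szq ?divnK //.
  have ltg := ltn_pmod i g0.
  rewrite -letters_nth // map_take nth_take //.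
  rewrite -letters_nth ?(leq_trans ltg) //.
  by apply: (periodic_mod pg); rewrite modn_mod.
apply/existsP=> -[[r /= ltr] /and3P[r1 rm /eqP E]].
have e0 : 0 < m %/ r by rewrite divn_gt0; lia.
have szq : size (map val (take (m %/ r) w)) = m %/ r.
  by rewrite size_map size_takel // size_tuple leq_div.
have: m %| m %/ r.
  apply: prim => i.
  have red x : letters w x = nth 0 (map val (take (m %/ r) w)) (x %% (m %/ r)).
    rewrite /letters {1}E map_flatten_nseq nth_flatten_nseq szq.
      by rewrite modn_dvdm // dvdn_div.
    by rewrite mulnC divnK // ltn_mod.
  by rewrite !red modnDr.
move/(dvdn_leq e0); rewrite leqNgt ltn_Pdiv //.
Qed.

Lemma flips_letters sigma w :
  flips (nth true sigma) (letters w) m 0 = odd (o_sigma sigma w).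
Proof.
rewrite flips_odd_count; congr odd.
have -> : [seq letters w j | j <- iota 0 m] = map val w.
  apply: (@eq_from_nth _ 0); first by rewrite !size_map size_iota size_tuple.
  move=> i; rewrite size_map size_iota => lt.
  by rewrite (nth_map 0) ?size_iota // nth_iota // letters_nth.
by rewrite count_map.
Qed.

Lemma necklaceP w v :
  reflect (exists2 j, j < m & v = rot_tuple j w) (v \in necklace w).
Proof.
apply: (iffP imsetP) => [[[j /= ltj] _ ->]|[j lt ->]]; last first.
  by exists (Ordinal (leqW lt)).
(* The index [j = m] allowed by the definition repeats [j = 0]. *)
have [lt|le] := ltnP j m; first by exists j.
exists 0 => //; apply/letters_inj => i; rewrite !letters_rot //.
have -> : j = m by lia.
by rewrite letters_periodic addn0.
Qed.

Lemma necklace_refl w : w \in necklace w.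
Proof. by apply/necklaceP; exists 0 => //; apply: val_inj; rewrite /= rot0. Qed.

Lemma necklace_sub w v : v \in necklace w -> necklace v \subset necklace w.
Proof.
case/necklaceP=> a lta ->; apply/subsetP=> u /necklaceP[b ltb ->].
apply/necklaceP; exists ((a + b) %% m); first by rewrite ltn_mod.
apply: letters_inj => i; rewrite !letters_rot //; try lia.
by rewrite /letters modnDmr -addnA [b + a]addnC.
Qed.

Lemma necklace_sym w v : v \in necklace w -> w \in necklace v.
Proof.
case/necklaceP=> a lta ->; apply/necklaceP; exists ((m - a) %% m); first by rewrite ltn_mod.
apply: letters_inj => i; rewrite !letters_rot //; try lia.
rewrite /letters -modnDml modnDmr modnDml -addnA subnK; last lia.
by rewrite modnDr.
Qed.

Lemma eq_necklace w v : (necklace v == necklace w) = (v \in necklace w).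
Proof.
apply/eqP/idP => [<-|vw]; first exact: necklace_refl.
by apply/eqP; rewrite eqEsubset !necklace_sub // necklace_sym.
Qed.

Lemma primitive_rot w j : j <= m -> primitive_word (rot_tuple j w) = primitive_word w.
Proof.
move=> le; suff per d : periodic (letters (rot_tuple j w)) d <-> periodic (letters w) d.
  by apply/primitive_wordP/primitive_wordP => -[/per p1 p2]; split=> // e /per; apply: p2.
split=> pd i; last by rewrite !letters_rot // addnAC pd.
rewrite -(letters_periodic w i) -(letters_periodic w (i + d)).
have -> : i + d + m = (i + (m - j) + d) + j by lia.
have -> : i + m = i + (m - j) + j by lia.
by rewrite -!(letters_rot w _ le) pd.
Qed.

Lemma o_sigma_rot sigma w j : o_sigma sigma (rot_tuple j w) = o_sigma sigma w.
Proof. by rewrite /o_sigma; apply/seq.permP; rewrite perm_rot. Qed.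

(** Equal rotations by [a <= b < m] give the period [b - a], which [m] divides only if it is 0. *)
Lemma card_necklace w : primitive_word w -> #|necklace w| = m.
Proof.
case/primitive_wordP=> _ prim.
pose h (j : 'I_m) := rot_tuple j w.
have -> : necklace w = [set h j | j : 'I_m].
  apply/setP=> v; apply/necklaceP/imsetP => [[j lt ->]|[j _ ->]].
    by exists (Ordinal lt).
  by exists j.
rewrite card_imset ?card_ord // => a b eqh.
wlog leab : a b eqh / a <= b.
  by move=> H; case: (leqP a b) => [|/ltnW] le; [apply: H | apply/esym/H].
have: m %| b - a.
  apply: prim => i; rewrite -(letters_periodic w i) -(letters_periodic w (i + _)).
  have la := ltn_ord a.
  have -> : i + m = (i + (m - a)) + a by lia.
  have -> : i + (b - a) + m = (i + (m - a)) + b by lia.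
  have lb := ltn_ord b.
  by rewrite -(letters_rot w _ (ltnW la)) -(letters_rot w _ (ltnW lb));
    congr letters; exact: esym eqh.
have [/eqP|ba0] := posnP (b - a).
  by rewrite subn_eq0 => leba _; apply/val_inj/eqP; rewrite eqn_leq leab.
by move/(dvdn_leq ba0); have := ltn_ord b; lia.
Qed.

Lemma card_primitive_words (Q : pred (m.-tuple 'I_k)) :
    (forall w j, Q (rot_tuple j w) = Q w) ->
  #|[set w | primitive_word w && Q w]| =
  m * #|[set necklace w | w : m.-tuple 'I_k & primitive_word w && Q w]|.
Proof.
move=> rotQ.
have -> : [set necklace w | w : m.-tuple 'I_k & primitive_word w && Q w] =
    (@necklace k m) @: [set w | primitive_word w && Q w].
  by apply/setP=> N; apply/imsetP/imsetP => -[w hw ->]; exists w => //; move: hw; rewrite !inE.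
rewrite mulnC -sum_nat_const -sum1_card (partition_big_imset (@necklace k m)) /=.
apply: eq_bigr => N /imsetP[w]; rewrite inE => /andP[pw Qw] ->.
rewrite -[RHS](card_necklace pw) -sum1_card; apply: eq_bigl => v.
rewrite inE eq_necklace andb_idl // => /necklaceP[j lt ->].
by rewrite rotQ Qw primitive_rot ?pw // ltnW.
Qed.

Lemma card_primitive_odd sigma :
  #|[set w : m.-tuple 'I_k | primitive_word w && odd (o_sigma sigma w)]| =
  m * Lneck_sig k m sigma.
Proof. by apply: card_primitive_words => w j; rewrite o_sigma_rot. Qed.

Lemma card_primitive : #|[set w : m.-tuple 'I_k | primitive_word w]| = m * Lneck k m.
Proof.
have := @card_primitive_words xpredT (fun _ _ => erefl).
have -> : [set w : m.-tuple 'I_k | primitive_word w && true] = [set w | primitive_word w].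
  by apply/setP => w; rewrite !inE andbT.
move=> ->; congr (_ * #|pred_of_set _|).
Qed.

End Words.

Lemma not_primitive_root k m (w : m.-tuple 'I_k) : 0 < m -> ~~ primitive_word w ->
  exists r, [/\ 1 < r, r %| m & exists q : (m %/ r).-tuple 'I_k, letters w =1 letters q].
Proof.
move=> m_gt0; rewrite negbK => /existsP[[r /= ltr] /and3P[r1 rm /eqP E]].
have d0 : 0 < m %/ r by rewrite divn_gt0; lia.
have szq : size (take (m %/ r) w) == m %/ r by rewrite size_takel // size_tuple leq_div.
exists r; split=> //; exists (Tuple szq) => i.
rewrite /letters {1}E map_flatten_nseq nth_flatten_nseq size_map (eqP szq).
  by rewrite modn_dvdm // dvdn_div.
by rewrite mulnC divnK // ltn_mod.
Qed.

(** * Cyclic permutations through the iterates of one point *)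

Section CyclicPermutations.

Variables (n : nat) (pi : 'S_n).

Lemma cyclicp_porbit x : cyclicp pi -> porbit pi x = setT.
Proof.
case/cards1P=> O eqO; apply/setP=> y; rewrite inE.
have mem z : porbit pi z = O.
  by apply/set1P; rewrite -eqO imset_f.
by rewrite mem -(mem y) porbit_id.
Qed.

Lemma cyclicp_card_porbit x : cyclicp pi -> #|porbit pi x| = n.
Proof. by move/(cyclicp_porbit x)->; rewrite cardsT card_ord. Qed.

Lemma cyclicp_iter x i j : cyclicp pi ->
  (iter i pi x == iter j pi x) = (i == j %[mod n]).
Proof.
move=> cyc; have cn := cyclicp_card_porbit x cyc.
have iter_n : iter n pi x = x by have := iter_porbit pi x; rewrite cn.
have n0 : 0 < n by exact: leq_ltn_trans (leq0n x) (ltn_ord x).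
have red a : iter a pi x = iter (a %% n) pi x.
  rewrite {1}(divn_eq a n) addnC iterD; congr iter.
  by elim: (a %/ n) => // b IH; rewrite mulSn addnC iterD iter_n.
have := uniq_traject_porbit pi x; rewrite cn => /(nth_uniq x) U.
rewrite (red i) (red j) -(nth_traject pi (ltn_pmod i n0)).
by rewrite -(nth_traject pi (ltn_pmod j n0)) U // size_traject ltn_mod.
Qed.

Lemma cyclicp_of_iter x : (forall y, exists i, y = iter i pi x) -> cyclicp pi.
Proof.
move=> H; apply/cards1P; exists (porbit pi x); apply/setP=> O; rewrite inE.
apply/imsetP/eqP=> [[y _ ->]|->]; last by exists x.
by have [i ->] := H y; apply/eqP; rewrite eq_porbit_mem -permX mem_porbit.
Qed.

End CyclicPermutations.

(** * Pointed labeled cycles and their itineraries *)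

Section PointedLabelings.

Variables (k n : nat) (sigma : seq bool).
Hypothesis n_gt0 : 0 < n.

Local Notation sg := (nth true sigma).

(** One condition on pairs captures both weakly increasing letters and the prescribed monotonicity
    on each letter class. Letters not taken stand for empty segments. *)
Definition labeling (pi : 'S_n) (l : {ffun 'I_n -> 'I_k}) : bool :=
  [forall x : 'I_n, forall y : 'I_n, (x < y) ==>
    ((l x < l y) || (l x == l y) && (if sg (l x) then pi x < pi y else pi y < pi x))].

Definition labeled_cycles : {set 'S_n * {ffun 'I_n -> 'I_k}} :=
  [set x | cyclicp x.1 && labeling x.1 x.2].

Implicit Types t : 'S_n * {ffun 'I_n -> 'I_k} * 'I_n.

Definition pointed : {set 'S_n * {ffun 'I_n -> 'I_k} * 'I_n} :=
  [set t | t.1 \in labeled_cycles].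

Lemma card_pointed : #|pointed| = #|labeled_cycles| * n.
Proof.
rewrite -[X in _ * X](card_ord n) -(cardsT 'I_n) -cardsX.
by apply: eq_card => t; rewrite !inE andbT.
Qed.

Definition visit t (i : nat) : nat := iter i t.1.1 t.2.

Definition itinerary t : n.-tuple 'I_k := [tuple t.1.2 (iter i t.1.1 t.2) | i < n].

Lemma ranking_visit t : t \in pointed -> ranking n (visit t).
Proof.
rewrite !inE => /andP[cyc _]; split=> [i|i j]; first exact: ltn_ord.
by rewrite -(cyclicp_iter t.2 i j cyc).
Qed.

Lemma letters_itinerary t i : t \in pointed ->
  letters (itinerary t) i = t.1.2 (iter i t.1.1 t.2).
Proof.
rewrite !inE => /andP[cyc _].
have lt := ltn_pmod i n_gt0.
rewrite /letters (nth_map (t.1.2 t.2)) ?size_tuple //.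
rewrite -[X in nth _ _ X]/(val (Ordinal lt)) -tnth_nth tnth_mktuple /=.
suff -> : iter (i %% n) t.1.1 t.2 = iter i t.1.1 t.2 by [].
by apply/eqP; rewrite cyclicp_iter // modn_mod.
Qed.

(** The labeling condition is an implication for x < y; applied to the swapped pair it also refutes
    the converse, so trichotomy yields an equivalence. *)
Lemma compat_visit t : t \in pointed ->
  compat sg (letters (itinerary t)) (visit t).
Proof.
move=> tP i j; have := tP; rewrite !inE => /andP[cyc /forallP lab].
rewrite /key_rel /= !letters_itinerary // /visit !iterS.
move: (iter i _ _) (iter j _ _) => x y.
have labE (a b : 'I_n) : a < b -> _ := fun h => implyP (forallP (lab a) b) h.
have [lt|lt|/val_inj ->] := ltngtP (val x) (val y).
- by have := labE _ _ lt; rewrite -(inj_eq val_inj) /= => ->.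
- have := labE _ _ lt; rewrite -(inj_eq val_inj) /=.
  case: (ltngtP (t.1.2 y) (t.1.2 x)) => //= ->.
  by case: ifP => _; case: ltngtP.
- by rewrite !ltnn eqxx /=; case: ifP.
Qed.

Lemma pointed_exists (w : n.-tuple 'I_k) P :
    ranking n P -> compat sg (letters w) P ->
  exists2 t, t \in pointed & itinerary t = w /\ visit t =1 P.
Proof.
move=> [ltP injP] cP.
pose p0 (j : 'I_n) := Ordinal (ltP j).
have injp : injective p0.
  move=> a b /(congr1 val)/= /eqP; rewrite injP !modn_small // => /eqP eqab.
  exact: val_inj.
pose p := perm injp.
(* The rotation i -> i + 1 of Z/n, transported by the ranking: time [i] is placed at position
   [P i]. *)
pose pi : 'S_n := (p^-1 * perm (@ordS_inj n) * p)%g.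
pose z : 'I_n := Ordinal n_gt0.
pose l := [ffun x => tnth w (p^-1%g x)].
have iterE i : iter i pi (p z) = p (Ordinal (ltn_pmod i n_gt0)).
  elim: i => [|i IH] /=; first by apply: (congr1 p); apply: val_inj; rewrite /= mod0n.
  rewrite IH /pi !permM permK (permE (@ordS_inj n)); apply: (congr1 p); apply: val_inj => /=.
  by rewrite -addn1 modnDml addn1.
have visE i : iter i pi (p z) = P i :> nat.
  rewrite iterE permE /=; apply/eqP; rewrite injP modn_mod //.
have surj x : exists i, x = iter i pi (p z).
  exists (p^-1%g x); rewrite iterE -[LHS](permKV p); apply: (congr1 p); apply: val_inj.
  by rewrite /= modn_small.
have letE i : l (iter i pi (p z)) = letters w i :> nat.
  rewrite ffunE iterE permK (tnth_nth (tnth w z)) /letters (nth_map (tnth w z)) //.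
  by rewrite size_tuple ltn_mod.
have tP : (pi, l, p z) \in pointed.
  rewrite !inE /=; apply/andP; split; first exact: cyclicp_of_iter surj.
  apply/forallP=> x; apply/forallP=> y; apply/implyP.
  have [i ->] := surj x; have [j ->] := surj y.
  rewrite -!iterS -(inj_eq val_inj) /= !letE -!iterS !visE => lt.
  by have := cP i j; rewrite /key_rel lt /= => <-.
exists (pi, l, p z) => //; split=> [|i]; last exact: visE.
by apply: letters_inj => i; rewrite letters_itinerary // letE.
Qed.

(** The visits run through every position, so they determine the permutation and the base point, and
    the itinerary then determines the letters. *)
Lemma pointed_inj t t' : t \in pointed -> t' \in pointed ->
  itinerary t = itinerary t' -> visit t =1 visit t' -> t = t'.
Proof.
move=> tP tP' eqw eqv.
have eqi i : iter i t.1.1 t.2 = iter i t'.1.1 t'.2 by apply/val_inj/eqv.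
have cyc : cyclicp t.1.1 by move: tP; rewrite !inE => /andP[].
have surj x : exists i, x = iter i t.1.1 t.2.
  have : x \in porbit t.1.1 t.2 by rewrite cyclicp_porbit.
  by case/porbitP=> i ->; exists i; rewrite permX.
have eq2 : t.2 = t'.2 := eqi 0.
have eq11 : t.1.1 = t'.1.1.
  by apply/permP=> x; have [i ->] := surj x; rewrite -iterS eqi iterS -eqi.
have eq12 : t.1.2 = t'.1.2.
  apply/ffunP=> x; have [i ->] := surj x; apply: val_inj => /=.
  by rewrite -letters_itinerary // eqw letters_itinerary // eqi.
by case: t t' eq2 eq11 eq12 {tP tP' eqw eqv eqi cyc surj} => [[? ?] ?] [[? ?] ?] /= -> -> ->.
Qed.

Definition fiber (w : n.-tuple 'I_k) := [set t in pointed | itinerary t == w].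

Lemma in_fiber t w : (t \in fiber w) = (t \in pointed) && (itinerary t == w).
Proof. by rewrite in_set. Qed.

Lemma card_fiber_primitive w : primitive_word w -> #|fiber w| = 1.
Proof.
move/(primitive_wordP n_gt0) => prim.
have [P rP cP] := compat_exists_primitive sg n_gt0 prim.
have [t tP [tw tv]] := pointed_exists rP cP.
apply/eqP/cards1P; exists t; apply/setP=> t'; rewrite in_fiber in_set1.
apply/andP/eqP => [[tP' /eqP tw']|->]; last by rewrite tw.
apply: pointed_inj; rewrite ?tw ?tw' //.
apply: (compat_unique_primitive (sg := sg) n_gt0 prim); try exact: ranking_visit.
  by rewrite -tw'; apply: compat_visit.
by rewrite -tw; apply: compat_visit.
Qed.


(** Twice any period carries an even number of '-', so [n] divides it. A proper root thus has length
    exactly n/2 and is primitive; even parity would force [n] to divide n/2. *)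
Lemma pointed_itinerary t : t \in pointed -> ~~ primitive_word (itinerary t) ->
  exists2 d, n = d + d & exists q : d.-tuple 'I_k,
    [/\ primitive_word q, odd (o_sigma sigma q) & letters (itinerary t) =1 letters q].
Proof.
move=> tP /(not_primitive_root n_gt0)[r [r1 rn [q Wq]]].
have rP := ranking_visit tP; have cP := compat_visit tP.
set W := letters (itinerary t) in cP Wq.
have even2 d : periodic W d -> n %| d + d.
  move=> pd; apply: (compat_even_period n_gt0 rP cP); first by move=> i; rewrite addnA !pd.
  by rewrite flipsD (flips_periodic _ (0 + d) pd) addbb.
have d0 : 0 < n %/ r by rewrite (divn_gt0 _ (ltnW r1)); apply: dvdn_leq.
have pd : periodic W (n %/ r) by move=> i; rewrite !Wq letters_periodic.
have nd : n = n %/ r + n %/ r.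
  have le : n <= n %/ r + n %/ r by apply: dvdn_leq (even2 _ pd); rewrite addn_gt0 d0.
  have := leq_mul r1 (leqnn (n %/ r)); rewrite [r * _]mulnC divnK //; lia.
exists (n %/ r) => //; exists q; split=> //.
  apply/(primitive_wordP d0); split=> [|e pe]; first exact: letters_periodic.
  have pe' : periodic W e by move=> i; rewrite !Wq pe.
  by have := even2 e pe'; rewrite {1}nd !addnn -!mul2n dvdn_pmul2l.
rewrite -flips_letters.
have <- : flips sg W (n %/ r) 0 = flips sg (letters q) (n %/ r) 0.
  by rewrite !flips_odd_count (eq_map Wq).
have [//|ev] := boolP (flips sg W (n %/ r) 0).
have := dvdn_leq d0 (compat_even_period n_gt0 rP cP pd ev); lia.
Qed.

End PointedLabelings.

(** * The two pointed cycles over a doubled word *)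

Section DoubleWords.

Variables (k d : nat) (sigma : seq bool).
Hypothesis d_gt0 : 0 < d.

Local Notation sg := (nth true sigma).

Let n_gt0 : 0 < d + d. Proof. lia. Qed.

Lemma letters_double (q : d.-tuple 'I_k) : letters (cat_tuple q q) =1 letters q.
Proof.
move=> i; rewrite /letters map_cat nth_cat size_map size_tuple.
have := ltn_pmod i n_gt0.
have -> : i %% d = i %% (d + d) %% d.
  by rewrite modn_dvdm // addnn -mul2n dvdn_mull.
move: (i %% (d + d)) => r lt; case: ltnP => le; first by rewrite modn_small.
by rewrite -[in RHS](subnK le) modnDr modn_small //; lia.
Qed.

Lemma double_inj : injective (fun q : d.-tuple 'I_k => cat_tuple q q).
Proof.
by move=> q q' /= eqq; apply: letters_inj => // i; rewrite -!letters_double eqq.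
Qed.

Lemma double_not_primitive (q : d.-tuple 'I_k) : ~~ primitive_word (cat_tuple q q).
Proof.
apply/negP=> /(primitive_wordP n_gt0)[_ /(_ d)].
suff pd : periodic (letters (cat_tuple q q)) d by move/(_ pd)/(dvdn_leq d_gt0); lia.
by move=> i; rewrite !letters_double letters_periodic.
Qed.

Lemma card_fiber_double (q : d.-tuple 'I_k) :
  primitive_word q -> odd (o_sigma sigma q) -> #|fiber sigma (cat_tuple q q)| = 2.
Proof.
move=> /(primitive_wordP d_gt0) [pq primq] oddq.
set w := cat_tuple q q; have eqW := letters_double q.
have prim : primitive_period (letters w) d.
  split=> [i|e pe]; first by rewrite !eqW pq.
  by apply: primq => i; rewrite -!eqW pe.
have oddW : flips sg (letters w) d 0.
  by rewrite flips_odd_count (eq_map eqW) -flips_odd_count flips_letters.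
have [P rP cP] := compat_exists_double d_gt0 prim oddW.
have [t tP [tw tv]] := pointed_exists n_gt0 rP cP.
(* Moving the base point by [d] steps keeps the word but exchanges the visits at times 0 and [d];
   this is the second solution. *)
pose t' := (t.1, iter d t.1.1 t.2).
have tP' : t' \in pointed k (d + d) sigma by move: tP; rewrite !inE.
have tv' i : visit t' i = visit t (i + d) by rewrite /visit /= iterD.
have tw' : itinerary t' = w.
  apply: letters_inj => // i; rewrite -[RHS](proj1 prim) -tw.
  rewrite (letters_itinerary n_gt0 i tP') (letters_itinerary n_gt0 _ tP).
  by rewrite [in RHS]iterD.
have [_ injt] := ranking_visit tP.
have t0d : visit t 0 != visit t d.
  by rewrite injt mod0n modn_small ?(eq_sym 0); lia.
have tdd : visit t (d + d) = visit t 0 by apply/eqP; rewrite injt modnn mod0n.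
have uniq_t u v : u \in pointed k (d + d) sigma -> v \in pointed k (d + d) sigma ->
    itinerary u = w -> itinerary v = w ->
    (visit u 0 < visit u d) = (visit v 0 < visit v d) -> u = v.
  move=> uP vP uw vw eq0; apply: (pointed_inj n_gt0 uP vP); first by rewrite uw vw.
  have cu := compat_visit n_gt0 uP; have cv := compat_visit n_gt0 vP.
  rewrite uw in cu; rewrite vw in cv.
  exact: (compat_unique_double d_gt0 prim oddW (ranking_visit uP) (ranking_visit vP) cu cv).
have -> : fiber sigma w = [set t; t'].
  apply/setP=> u; rewrite in_fiber in_set2.
  apply/andP/orP => [[uP /eqP uw]|[] /eqP ->]; last 2 first.
  - by rewrite tw.
  - by rewrite tw'.
  have [h|h] := boolP ((visit u 0 < visit u d) == (visit t 0 < visit t d)).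
    by left; apply/eqP; exact: (uniq_t _ _ uP tP uw tw (eqP h)).
  right; apply/eqP; apply: (uniq_t _ _ uP tP' uw tw'); move: h.
  by rewrite !tv' add0n tdd; case: (visit u 0 < _); case: ltngtP t0d.
have neqt : t != t'.
  by apply: contraNneq t0d => /(congr1 (fun u => visit u 0)); rewrite tv' add0n => ->.
by rewrite cards2 neqt.
Qed.

End DoubleWords.

(** * Counting labeled cycles by necklaces *)

Lemma card_pointed_fibers k n sigma :
  #|pointed k n sigma| = \sum_(w : n.-tuple 'I_k) #|fiber sigma w|.
Proof.
rewrite -sum1_card (partition_big (@itinerary k n) xpredT) //=.
apply: eq_bigr => w _; rewrite -sum1_card; apply: eq_bigl => t.
by rewrite in_fiber.
Qed.

Lemma card_pointed_words k n sigma : 0 < n ->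
  #|pointed k n sigma| = n * Lneck k n +
    \sum_(w : n.-tuple 'I_k | ~~ primitive_word w) #|fiber sigma w|.
Proof.
move=> n0; rewrite card_pointed_fibers (bigID (@primitive_word k n)) /=; congr (_ + _).
rewrite -card_primitive // -sum1_card; apply: eq_big => [w|w pw]; first by rewrite inE.
by rewrite card_fiber_primitive.
Qed.

Theorem card_labeled_cycles k n sigma : 0 < n ->
  #|labeled_cycles k n sigma| = Lstar k n sigma.
Proof.
move=> n0; apply/eqP; rewrite -(eqn_pmul2r n0) -card_pointed card_pointed_words // /Lstar.
rewrite mulnDl [_ * n]mulnC eqn_add2l; apply/eqP.
have [oddn|evn] := boolP (odd n).
  rewrite mul0n big1 // => w /negP npw; apply: eq_card0 => t; apply/negP.
  rewrite in_fiber => /andP[tP /eqP tw]; case: npw; rewrite -tw.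
  apply: contraT => /(pointed_itinerary n0 tP)[d nd _].
  by move: oddn; rewrite nd oddD addbb.
have nd : n = n./2 + n./2 by rewrite addnn even_halfK.
move: n./2 nd => d nd; move: n0; rewrite {n evn}nd => n0.
have d0 : 0 < d by lia.
(* Each odd primitive root of length [d] accounts for two pointed cycles; with [d] rotations per
   necklace this gives [d + d] per necklace, the number of base points. *)
transitivity (\sum_(q : d.-tuple 'I_k | primitive_word q && odd (o_sigma sigma q)) 2); last first.
  rewrite sum_nat_const addnn -muln2 mulnA; congr (_ * 2).
  by rewrite [RHS]mulnC -card_primitive_odd //; apply: eq_card => q; rewrite inE.
pose D := [set q : d.-tuple 'I_k | primitive_word q && odd (o_sigma sigma q)].
pose dbl (q : d.-tuple 'I_k) := cat_tuple q q.
(* Non-primitive words that do not double an odd primitive root have empty fibers. *)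
rewrite (bigID (mem (dbl @: D))) /= [X in _ + X]big1 => [|w /andP[npw /negP nD]]; last first.
  apply: eq_card0 => t; apply/negP; rewrite in_fiber => /andP[tP /eqP tw]; case: nD.
  rewrite -tw in npw *.
  have [d' dd' [q [pq oq eqq]]] := pointed_itinerary n0 tP npw.
  have {}dd' : d' = d by lia.
  rewrite {d'}dd' in q pq oq eqq.
  apply/imsetP; exists q; first by rewrite inE pq.
  by apply: letters_inj => // i; rewrite eqq letters_double.
rewrite addn0 (eq_bigl (mem (dbl @: D))) => [|w]; last first.
  rewrite andb_idl // => /imsetP[q _ ->]; exact: double_not_primitive.
rewrite big_imset /=; last by move=> q q' _ _; apply: double_inj.
apply: eq_big => [q|q]; first by rewrite inE.
by rewrite inE => /andP[pq oq]; apply: card_fiber_double.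
Qed.

(** * Breakpoint pairs for the pattern ++- *)

Section Segmentations.

Variables (up : nat -> bool) (n : nat).

(** [up x] stands for an ascent from [x] to [x.+1]. The steps into [e1] and into [e2] cross a
    breakpoint and are free. With [e1 = 0] this describes the pattern +-. *)
Definition segm (e1 e2 : nat) : bool :=
  [&& e1 <= e2, e2 <= n,
      [forall x : 'I_n, (x.+1 < e2) && (x.+1 != e1) ==> up x]
    & [forall x : 'I_n, (e2 <= x) && (x.+1 < n) ==> ~~ up x]].

Lemma segmP e1 e2 :
  reflect [/\ e1 <= e2, e2 <= n, forall x, x.+1 < e2 -> x.+1 != e1 -> up x
            & forall x, e2 <= x -> x.+1 < n -> ~~ up x]
          (segm e1 e2).
Proof.
apply: (iffP and4P) => [[le1 le2 /forallP inc /forallP dec]|[le1 le2 inc dec]]; split=> //.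
- move=> x lt neq; have ltn : x < n by lia.
  by have := inc (Ordinal ltn); rewrite /= lt neq.
- move=> x le lt; have ltn : x < n by lia.
  by have := dec (Ordinal ltn); rewrite /= le lt.
- by apply/forallP=> x; apply/implyP=> /andP[]; apply: inc.
- by apply/forallP=> x; apply/implyP=> /andP[]; apply: dec.
Qed.

Definition segmentations : {set 'I_n.+1 * 'I_n.+1} := [set e : 'I_n.+1 * 'I_n.+1 | segm e.1 e.2].

Lemma card_ord_le m : m <= n -> #|[set x : 'I_n.+1 | x <= m]| = m.+1.
Proof.
move=> le; rewrite -sum1_card -[RHS]card_ord -sum1_card.
rewrite [RHS](big_ord_widen n.+1 (fun=> 1)) ?ltnS //.
by apply: eq_bigl => x; rewrite inE ltnS.
Qed.

Lemma sum_ord_indicator a c : a <= n -> \sum_(x < n.+1) (x == a :> nat) * c = c.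
Proof.
move=> le; rewrite (bigD1 (Ordinal (le : a < n.+1))) //= eqxx mul1n big1 ?addn0 // => x.
by rewrite -(inj_eq val_inj) /= => /negPf ->.
Qed.

(** The peak [j] may open the last segment ([e2 = j], any [e1 <= j]) or close an ascending one
    ([e2 = j.+1], any [e1 <= j.+1]). With [e2 = j.+2] the descent after the peak must cross
    [e1 = j.+1]. The counts are j + 1, j + 2 and 1. *)
Lemma card_segmentations_unimodal j : 0 < j -> j.+1 < n ->
  (forall x, x.+1 < n -> up x = (x < j)) -> #|segmentations| = 2 * j.+1 + 2.
Proof.
move=> j0 jn upE.
have segE e1 e2 : segm e1 e2 =
    (e1 <= e2) && ((e2 == j) || (e2 == j.+1)) || (e2 == j.+2) && (e1 == j.+1).
  apply/segmP/idP => [[le1 le2 inc dec]|H].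
    have gej : j <= e2.
      rewrite leqNgt; apply/negP=> lt; have := dec e2 (leqnn _).
      rewrite upE ?lt; lia.
    have [le|gt] := leqP e2 j.+1; first by rewrite le1; lia.
    have e1j : e1 = j.+1.
      apply/eqP; apply: contraT => neq; have := inc j gt.
      rewrite eq_sym neq upE ?ltnn; lia.
    have [le|gt'] := leqP e2 j.+2; first lia.
    have := inc j.+1 gt'; rewrite upE; lia.
  split; try lia.
  - by move=> x lt neq; rewrite upE; lia.
  - by move=> x lt neq; rewrite upE; lia.
pose F (x : 'I_n.+1) := (x == j :> nat) * j.+1 + (x == j.+1 :> nat) * j.+2 + (x == j.+2 :> nat) * 1.
transitivity (\sum_(e2 < n.+1) F e2); last by rewrite !big_split /= !sum_ord_indicator; lia.
rewrite -sum1_card (partition_big (fun e => e.2) xpredT) //=.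
apply: eq_bigr => e2 _.
transitivity #|[set e1 : 'I_n.+1 | segm e1 e2]|.
  rewrite -sum1_card (reindex_onto (fun e1 => (e1, e2)) (fun e => e.1)) /=.
    by apply: eq_bigl => e1; rewrite !inE /= !eqxx !andbT.
  by move=> [a b] /andP[_ /eqP /= ->].
have -> : [set e1 : 'I_n.+1 | segm e1 e2] =
    if (e2 == j :> nat) || (e2 == j.+1 :> nat) then [set e1 : 'I_n.+1 | e1 <= e2]
    else if e2 == j.+2 :> nat then [set inord j.+1] else set0.
  apply/setP=> e1; rewrite inE segE.
  case: ifP => h1; first by rewrite inE andbT; lia.
  case: ifP => h2; rewrite !inE; last by lia.
  by rewrite -(inj_eq val_inj) /= inordK; lia.
rewrite /F (fun_if (fun A : {set 'I_n.+1} => #|A|)) (fun_if (fun A : {set 'I_n.+1} => #|A|)).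
rewrite cards1 cards0 card_ord_le ?leq_ord //.
case: (eqVneq (val e2) j) => [->|_].
  by rewrite (ltn_eqF (ltnSn j)) (ltn_eqF (leqW (ltnSn j))) /=; lia.
case: (eqVneq (val e2) j.+1) => [->|_]; first by rewrite (ltn_eqF (ltnSn j.+1)) /=; lia.
by case: (val e2 == _).
Qed.

(** Without a descent into [e1] and an ascent out of it the sequence would be unimodal, so this
    valley forces [e1]. The rest is unimodal, and its peak [p] may belong to either of the last two
    segments. *)
Lemma card_segmentations_other e1 e2 : segm e1 e2 -> (forall e, ~~ segm 0 e) ->
  #|segmentations| = 2.
Proof.
move=> /segmP[le1 le2 inc dec] nuni.
have nun e : e <= n -> (forall x, x.+1 < e -> up x) ->
   (forall x, e <= x -> x.+1 < n -> ~~ up x) -> False.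
  move=> le i d; have := nuni e; case/segmP; split=> // x h _; exact: i.
have desc : 0 < e1 /\ ~~ up e1.-1 /\ e1 < e2.
  have [h|h] := boolP [&& 0 < e1, ~~ up e1.-1 & e1 < e2]; first by case/and3P: h.
  case: (nun e2) => // x lt; have [E|] := eqVneq x.+1 e1; last exact: inc.
  by move: h; rewrite -E /= lt andbT negbK.
case: desc => e1_gt0 [nup lt12].
have asc : e1.+1 < n /\ up e1.
  have [h|h] := boolP ((e1.+1 < n) && up e1); first by case/andP: h.
  case: (nun e1) => [|x lt|x le lt]; first lia.
    by apply: inc; lia.
  have [E|neq] := eqVneq x e1; first by move: h; rewrite -E lt.
  have [lte|gee] := ltnP e1.+1 e2; last by apply: dec; lia.
  by move: h; rewrite inc ?andbT; lia.
case: asc => lt1n up1.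
have [p [p1 p2 pinc pdec]] : exists p, [/\ e1 < p, p < n,
    forall x, e1 <= x -> x < p -> up x & forall x, p <= x -> x.+1 < n -> ~~ up x].
  (* The peak opens the last segment if the step into [e2] ascends, and otherwise closes the second
     one. *)
  have [/andP[lt u]|h] := boolP ((e2 < n) && up e2.-1).
    exists e2; split=> // x h1 h2.
    have [E|] := eqVneq x e2.-1; first by rewrite E.
    by move=> ?; apply: inc; lia.
  exists e2.-1; split; try lia.
  - rewrite ltn_neqAle; apply/andP; split; last lia.
    apply: contraNneq h => E; rewrite -E up1; lia.
  - by move=> x h1 h2; apply: inc; lia.
  - move=> x h1 h2; have [E|] := eqVneq x e2.-1; last by move=> ?; apply: dec; lia.
    by move: h; rewrite negb_and E => /orP[|//]; lia.
have segE f1 f2 : segm f1 f2 = (f1 == e1) && ((f2 == p) || (f2 == p.+1)).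
  apply/segmP/idP => [[h1 h2 i d]|/andP[/eqP -> H]].
    have f2e : e1 < f2.
      by rewrite ltnNge; apply/negP=> le; have := d e1 le lt1n; rewrite up1.
    have f1e : f1 = e1.
      apply/eqP; apply: contraT => neq; have := i e1.-1.
      rewrite (negPf nup) prednK // eq_sym neq; lia.
    have fp : p <= f2.
      rewrite leqNgt; apply/negP=> lt; have := d f2 (leqnn _).
      rewrite pinc; lia.
    have [le|gt] := leqP f2 p.+1; first lia.
    have := pdec p (leqnn _); rewrite i; lia.
  split; try lia.
  - move=> x h1 h2; have [lt|ge] := ltnP x e1; first by apply: inc; lia.
    by apply: pinc; lia.
  - by move=> x h1 h2; apply: pdec; lia.
have -> : segmentations = [set (inord e1, inord p); (inord e1, inord p.+1)].
  apply/setP=> -[f1 f2]; rewrite !inE /= segE !xpair_eqE -!(inj_eq val_inj) /= !inordK; lia.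
by rewrite cards2 xpair_eqE eqxx -(inj_eq val_inj) /= !inordK; lia.
Qed.

End Segmentations.

(** * Pattern membership in terms of ascents *)

Definition ascent (s : seq nat) (x : nat) : bool := nth 0 s x < nth 0 s x.+1.

Lemma size_oneline n (pi : 'S_n) : size (oneline pi) = n.
Proof. by rewrite size_map size_enum_ord. Qed.

Lemma nth_oneline n (pi : 'S_n) (x : 'I_n) : nth 0 (oneline pi) x = pi x.
Proof. by rewrite (nth_map x) ?size_enum_ord // nth_ord_enum. Qed.

Lemma uniq_oneline n (pi : 'S_n) : uniq (oneline pi).
Proof.
by rewrite map_inj_uniq ?enum_uniq // => x y /val_inj/perm_inj.
Qed.

Lemma in_pattern_cons b sigma t :
  reflect (exists j, [/\ j <= size t, monseg b (take j t) & in_pattern sigma (drop j t)])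
          (in_pattern (b :: sigma) t).
Proof.
apply: (iffP existsP) => [[j /andP[mon pat]]|[j [le mon pat]]].
  by exists j; rewrite -ltnS ltn_ord.
by exists (inord j); rewrite inordK // mon.
Qed.

Lemma in_pattern_minus t : in_pattern [:: false] t = sorted gtn t.
Proof.
apply/in_pattern_cons/idP => [[j [_ srt /eqP E]]|srt].
  by rewrite -(cat_take_drop j t) E cats0.
by exists (size t); rewrite take_size drop_size.
Qed.

Section Patterns.

Variable s : seq nat.
Hypothesis uniq_s : uniq s.

Lemma sorted_gtn_drop e :
  reflect (forall x, e <= x -> x.+1 < size s -> ~~ ascent s x) (sorted gtn (drop e s)).
Proof.
apply: (iffP (sortedP 0)) => [H x le lt|H x].
  have := H (x - e); rewrite size_drop !nth_drop addnS subnKC // /ascent -leqNgt => h.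
  by apply/ltnW/h; lia.
rewrite size_drop !nth_drop addnS => lt.
have lt' : (e + x).+1 < size s by lia.
have := H (e + x) (leq_addr _ _) lt'.
rewrite /ascent -leqNgt leq_eqVlt nth_uniq //; last by apply: ltnW.
by rewrite (gtn_eqF (ltnSn _)).
Qed.

Lemma sorted_ltn_segment e e' : e <= e' -> e' <= size s ->
  reflect (forall x, e <= x -> x.+1 < e' -> ascent s x) (sorted ltn (take (e' - e) (drop e s))).
Proof.
move=> le le'; have sz : size (take (e' - e) (drop e s)) = e' - e.
  by rewrite size_takel // size_drop; lia.
apply: (iffP (sortedP 0)); rewrite sz => H x.
  move=> lex lt; have := H (x - e).
  rewrite !nth_take; [|lia..].
  by rewrite !nth_drop addnS subnKC // /ascent; apply; lia.
move=> lt; rewrite !nth_take; [|lia..].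
by rewrite !nth_drop addnS; apply: H; lia.
Qed.

Lemma in_pattern_unimodal :
  reflect (exists e, segm (ascent s) (size s) 0 e) (in_pattern [:: true; false] s).
Proof.
apply: (iffP (in_pattern_cons _ _ _)) => [[j [lej inc]]|[e /segmP[_ le inc dec]]].
  rewrite in_pattern_minus => /sorted_gtn_drop dec; exists j.
  have h : sorted ltn (take (j - 0) (drop 0 s)) by rewrite subn0 drop0.
  by apply/segmP; split=> // x lt _; apply: (sorted_ltn_segment _ _ h).
exists e; split=> //; last by rewrite in_pattern_minus; apply/sorted_gtn_drop.
rewrite /= -(subn0 e) -(drop0 s).
by apply/sorted_ltn_segment => // x _ lt; apply: inc.
Qed.

Lemma in_pattern_sigma5 :
  reflect (exists e1 e2, segm (ascent s) (size s) e1 e2) (in_pattern sigma5 s).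
Proof.
apply: (iffP (in_pattern_cons _ _ _)) => [[j [lej inc]]|[e1 [e2 /segmP[le1 le2 inc dec]]]].
  case/in_pattern_cons=> j2; rewrite size_drop in_pattern_minus drop_drop.
  case=> le2 inc2 /sorted_gtn_drop dec; exists j, (j2 + j).
  have lej2 : j2 + j <= size s by lia.
  apply/segmP; split=> // [|x lt neq]; first lia.
  have [ltj|gej] := ltnP x.+1 j.
    have h : sorted ltn (take (j - 0) (drop 0 s)) by rewrite subn0 drop0.
    exact: (sorted_ltn_segment _ _ h).
  have h : sorted ltn (take (j2 + j - j) (drop j s)) by rewrite addnK.
  by apply: (sorted_ltn_segment _ _ h) => //; lia.
exists e1; split; first by lia.
  rewrite /= -(subn0 e1) -(drop0 s).
  by apply/sorted_ltn_segment => // [|x _ lt]; [lia|apply: inc; lia].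
apply/in_pattern_cons; exists (e2 - e1); rewrite size_drop in_pattern_minus drop_drop subnK //.
split; [lia | | exact/sorted_gtn_drop].
by apply/sorted_ltn_segment => // x le lt; apply: inc; lia.
Qed.

End Patterns.

(** * Labelings for ++- are segmentations *)

Section LabelingsSigma5.

Variables (n : nat) (pi : 'S_n).

Let s := oneline pi.

(** The index of the segment that holds [x], for [e.1 <= e.2]. *)
Definition label_of (e : 'I_n.+1 * 'I_n.+1) : {ffun 'I_n -> 'I_3} :=
  [ffun x : 'I_n => inord ((e.1 <= x) + (e.2 <= x))].

Lemma label_ofE e x : label_of e x = (e.1 <= x) + (e.2 <= x) :> nat.
Proof. by rewrite ffunE inordK //; case: (e.1 <= x); case: (e.2 <= x). Qed.

Lemma increasing_run (f : nat -> nat) x y : x < y ->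
  (forall z, x <= z -> z < y -> f z < f z.+1) -> f x < f y.
Proof.
elim: y => // y IH; rewrite ltnS leq_eqVlt => /orP[/eqP<-|lt] H; first exact: H.
apply: (@ltn_trans (f y)); last by apply: H => //; apply: ltnW.
by apply: IH => // z le1 le2; apply: H => //; apply: ltnW.
Qed.

Lemma ascentN x : x.+1 < n -> ~~ ascent s x = (nth 0 s x.+1 < nth 0 s x).
Proof.
move=> lt; rewrite /ascent -leqNgt leq_eqVlt nth_uniq ?size_oneline ?uniq_oneline //; lia.
Qed.

Lemma decreasing_run (f : nat -> nat) x y : x < y ->
  (forall z, x <= z -> z < y -> f z.+1 < f z) -> f y < f x.
Proof.
elim: y => // y IH; rewrite ltnS leq_eqVlt => /orP[/eqP<-|lt] H; first exact: H.
apply: (@ltn_trans (f y)); first by apply: H => //; apply: ltnW.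
by apply: IH => // z le1 le2; apply: H => //; apply: ltnW.
Qed.

Lemma labeling_label_of (e : 'I_n.+1 * 'I_n.+1) :
  segm (ascent s) n e.1 e.2 -> labeling sigma5 pi (label_of e).
Proof.
case/segmP=> le1 le2 inc dec; apply/forallP=> x; apply/forallP=> y; apply/implyP=> lt.
rewrite -(inj_eq val_inj) /= !label_ofE -!nth_oneline.
have ltn := ltn_ord y.
case: (leqP e.2 x) => [l2|g2].
  have -> : e.1 <= x by lia.
  have -> : e.1 <= y by lia.
  have -> : e.2 <= y by lia.
  by apply: decreasing_run => // z h1 h2; rewrite -ascentN; [apply: dec|]; lia.
case: (leqP e.2 y) => [l2'|g2'].
  have -> : e.1 <= y by lia.
  by case: (e.1 <= x).
rewrite !addn0; case: (leqP e.1 x) => [l1|g1].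
  have -> : e.1 <= y by lia.
  by apply: increasing_run => // z h1 h2; apply: inc; lia.
case: (leqP e.1 y) => [//|g1'] /=.
by apply: increasing_run => // z h1 h2; apply: inc; lia.
Qed.

Lemma downset_ord (D : pred 'I_n) : (forall x y : 'I_n, x < y -> D y -> D x) ->
  exists e : 'I_n.+1, forall x : 'I_n, D x = (x < e).
Proof.
(* The empty maximum 0 is the right cut for an empty [D]. *)
move=> down; pose m := \max_(x | D x) x.+1.
have lem : m < n.+1 by rewrite ltnS; apply/bigmax_leqP => x _; apply: ltn_ord.
exists (Ordinal lem) => x /=; apply/idP/idP => [Dx|].
  exact: (leq_bigmax_cond (F := fun x : 'I_n => x.+1)).
apply: contraTT => nDx; rewrite -leqNgt; apply/bigmax_leqP => y Dy.
rewrite ltnNge; apply: contra nDx; rewrite leq_eqVlt => /orP[/eqP/val_inj -> //|lt].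
exact: down Dy.
Qed.

Lemma labeling_segm l : labeling sigma5 pi l ->
  exists2 e : 'I_n.+1 * 'I_n.+1, segm (ascent s) n e.1 e.2 & l = label_of e.
Proof.
move/forallP=> lab.
have labE (x y : 'I_n) : x < y -> _ := fun h => implyP (forallP (lab x) y) h.
have mono (x y : 'I_n) : x < y -> l x <= l y.
  by move/labE=> /orP[/ltnW//|/andP[/eqP -> _]].
(* The breakpoints are where the letters reach 1 and 2. *)
have [x y lt h|e1 E1] := @downset_ord (fun x => l x < 1); first by have := mono x y lt; lia.
have [x y lt h|e2 E2] := @downset_ord (fun x => l x < 2); first by have := mono x y lt; lia.
have le2 : e2 <= n by rewrite -ltnS.
have le1 : e1 <= n by rewrite -ltnS.
have le12 : e1 <= e2.
  rewrite leqNgt; apply/negP=> lt; have ltn : e2 < n by lia.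
  by have := E1 (Ordinal ltn); have := E2 (Ordinal ltn); rewrite /= lt ltnn; lia.
exists (e1, e2); last first.
  apply/ffunP=> x; apply: val_inj; rewrite /= label_ofE /= (leqNgt e1) (leqNgt e2) -E1 -E2.
  by case: (l x) => [[|[|[|]]]].
apply/segmP; split=> //= x.
  move=> lt neq; have xn : x < n by lia.
  have xn' : x.+1 < n by lia.
  pose a := Ordinal xn; pose b := Ordinal xn'.
  have := labE a b (ltnSn _); rewrite -!nth_oneline -[nth _ _ a < _]/(ascent s x).
  have := E1 a; have := E1 b; have := E2 a; have := E2 b; rewrite -(inj_eq val_inj) /=.
  case: (val (l a)) (val (l b)) => [|[|?]] [|[|?]] //=; lia.
move=> lt xn'; have xn : x < n by lia.
pose a := Ordinal xn; pose b := Ordinal xn'.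
have := labE a b (ltnSn _); rewrite ascentN // -!nth_oneline.
have := E2 a; have := E2 b; rewrite -(inj_eq val_inj) /=.
have := ltn_ord (l a); have := ltn_ord (l b).
case: (nat_of_ord (l a)) (nat_of_ord (l b)) => [|[|[|?]]] [|[|[|?]]] //=; lia.
Qed.

Lemma card_labelings :
  #|[set l : {ffun 'I_n -> 'I_3} | labeling sigma5 pi l]| = #|segmentations (ascent s) n|.
Proof.
have -> : [set l : {ffun 'I_n -> 'I_3} | labeling sigma5 pi l] =
    label_of @: segmentations (ascent s) n.
  apply/setP => l; rewrite inE; apply/idP/imsetP => [/labeling_segm[e he ->]|[e + ->]].
    by exists e; rewrite ?inE.
  by rewrite inE => /labeling_label_of.
apply: card_in_imset.
move=> [e1 e2] [f1 f2]; rewrite !inE /= => /segmP[a1 a2 _ _] /segmP[b1 b2 _ _] eqe.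
have eqx x : x < n -> (e1 <= x) + (e2 <= x) = (f1 <= x) + (f2 <= x).
  move=> lt; have := label_ofE (e1, e2) (Ordinal lt).
  by rewrite eqe label_ofE /= => ->.
(* Comparing at the four breakpoints suffices; a breakpoint equal to [n] gives a vacuous
   instance. *)
have h1 := eqx e1; have h2 := eqx e2; have h3 := eqx f1; have h4 := eqx f2.
by congr pair; apply: val_inj => /=; lia.
Qed.

End LabelingsSigma5.

(** * The peak of a cyclic unimodal permutation *)

Section Peak.

Variables (m : nat) (pi : 'S_m.+1).

Let s := oneline pi.

(** The position is counted from 0, so the index of [Lambda] is [peak.+1]. *)
Definition peak : 'I_m.+1 := (pi^-1)%g ord_max.

(** No ascent leaves the maximum and no descent enters it, so [e] is [peak] or [peak.+1]. *)
Lemma unimodal_ascent e x : segm (ascent s) m.+1 0 e -> x < m -> ascent s x = (x < peak).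
Proof.
case/segmP=> _ le inc dec ltx.
have spk : nth 0 s peak = m by rewrite nth_oneline permKV.
have les y : y < m.+1 -> nth 0 s y <= m.
  by move=> lt; rewrite -[y]/(val (Ordinal lt)) nth_oneline -ltnS ltn_ord.
have ltpk := ltn_ord peak.
have nasc : peak < m -> ~~ ascent s peak.
  by move=> lt; rewrite /ascent spk -leqNgt; apply: les.
have asc : 0 < peak -> ascent s peak.-1.
  move=> lt; apply: contraT; rewrite ascentN ?prednK //.
  by rewrite spk => h; have := les _ (leq_ltn_trans (leq_pred _) ltpk); rewrite leqNgt h.
have ge1 : peak.+1 < e -> False.
  by move=> lt; have := inc peak lt isT; rewrite (negPf (nasc _)) //; lia.
have ge2 : e < peak -> False.
  by move=> lt; have /negP[] : ~~ ascent s peak.-1 by [apply: dec; lia]; apply: asc; lia.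
have [lt|ge] := ltnP x peak.
  have [E|neq] := eqVneq x peak.-1; first by rewrite E asc //; lia.
  by apply: inc => //; lia.
apply/negbTE; have [E|neq] := eqVneq x peak; first by rewrite E nasc // -E.
by apply: dec; lia.
Qed.

Hypotheses (m_gt1 : 1 < m) (cyc : cyclicp pi).

(** A maximum in last position would be a fixed point. *)
Lemma peak_lt : peak < m.
Proof.
have := ltn_ord peak; case: (ltngtP peak m) => // [lt|E _]; first by rewrite ltnS leqNgt lt.
have fixm : pi ord_max = ord_max by rewrite -{1}(_ : peak = ord_max) ?permKV //; apply: val_inj.
by have := cyclicp_iter ord_max 1 0 cyc; rewrite [iter 1 _ _]fixm eqxx mod0n;
  rewrite modn_small // ltnS ltnW.
Qed.

(** A maximum in first position makes the word decreasing, so the first and last positions form a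
    2-cycle, impossible for n >= 3. *)
Lemma peak_gt0 e : segm (ascent s) m.+1 0 e -> 0 < peak.
Proof.
move=> uni; rewrite lt0n; apply/eqP=> E.
have p0 : pi ord0 = ord_max by rewrite -(_ : peak = ord0) ?permKV //; apply: val_inj.
have pm : pi ord_max = ord0.
  pose y := (pi^-1)%g ord0; have py : pi y = ord0 by rewrite permKV.
  suff <- : y = ord_max by [].
  apply: val_inj; apply/eqP; rewrite /= eqn_leq -ltnS ltn_ord leqNgt /=; apply/negP=> lt.
  have: nth 0 s m < nth 0 s y.
    apply: decreasing_run => // z _ lz.
    by rewrite -ascentN // (unimodal_ascent uni lz) E.
  by rewrite nth_oneline py.
have := cyclicp_iter ord0 2 0 cyc; rewrite [iter 2 _ _](_ : _ = ord0) /= ?p0 // eqxx mod0n.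
by rewrite modn_small.
Qed.

(** A unimodal permutation also lies in the ++- class, so its count splits into 2 for that class and
    a surplus of [2 * peak.+1]. *)
Lemma card_labelings_cyclic :
  #|[set l : {ffun 'I_m.+1 -> 'I_3} | labeling sigma5 pi l]| =
  (in_pattern sigma5 s) * 2 + (in_pattern [:: true; false] s) * (2 * peak.+1).
Proof.
rewrite card_labelings -/s.
have us : uniq s := uniq_oneline pi.
have sz : size s = m.+1 := size_oneline pi.
have [/(in_pattern_unimodal us)[e]|nuni] := boolP (in_pattern [:: true; false] s).
  rewrite sz => uni.
  have -> : in_pattern sigma5 s by apply/(in_pattern_sigma5 us); exists 0, e; rewrite sz.
  rewrite (@card_segmentations_unimodal _ _ peak (peak_gt0 uni)) ?ltnS ?peak_lt //; first lia.
  by move=> x; rewrite ltnS => /(unimodal_ascent uni).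
have [/(in_pattern_sigma5 us)[e1 [e2]]|n5] := boolP (in_pattern sigma5 s).
  rewrite sz => he; rewrite (card_segmentations_other he) // => e.
  by apply: contra nuni => he'; apply/(in_pattern_unimodal us); exists e; rewrite sz.
apply: eq_card0 => e; rewrite inE; apply: contraNF n5 => he.
by apply/(in_pattern_sigma5 us); exists e.1, e.2; rewrite sz.
Qed.

End Peak.

(** * Summation over cyclic permutations *)

Lemma Lambda_peak m i : Lambda m.+1 i =
  \sum_(pi in Csigma m.+1 [:: true; false]) ((peak pi).+1 == i).
Proof.
rewrite /Lambda -sum1_card big_mkcond [RHS]big_mkcond; apply: eq_bigr => pi _.
rewrite inE; case: (pi \in _) => //=.
have -> : [exists j : 'I_m.+1, (j.+1 == i) && (val (pi j) == m)] = ((peak pi).+1 == i).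
  apply/existsP/idP => [[j /andP[/eqP <- /eqP E]]|E].
    have <- : j = peak pi by apply: (@perm_inj _ pi); rewrite permKV; apply: val_inj.
    exact: eqxx.
  by exists (peak pi); rewrite E permKV /=.
by case: eqP.
Qed.

(** Permutations are grouped by peak; the bounds 2 and n-1 hold because the peak is neither first
    nor last. *)
Lemma sum_peak m : 1 < m ->
  \sum_(pi in Csigma m.+1 [:: true; false]) (peak pi).+1 =
  \sum_(2 <= i < m.+1) i * Lambda m.+1 i.
Proof.
move=> m1; under [RHS]eq_bigr do rewrite Lambda_peak big_distrr /=.
rewrite exchange_big /=; apply: eq_bigr => pi; rewrite inE => /andP[cyc].
case/(in_pattern_unimodal (uniq_oneline pi)) => e; rewrite size_oneline => uni.
have gt := peak_gt0 m1 cyc uni; have lt := peak_lt m1 cyc.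
rewrite (bigD1_seq (peak pi).+1) ?iota_uniq ?mem_index_iota //=; last by lia.
rewrite eqxx muln1 big1 ?addn0 // => i neq.
by rewrite eq_sym (negPf neq) muln0.
Qed.

(** Labeled cycles are counted twice: by necklaces, and permutation by permutation. *)
Lemma Lstar_sigma5 n : 2 < n ->
  Lstar 3 n sigma5 = 2 * c5 n + 2 * \sum_(2 <= i < n) i * Lambda n i.
Proof.
case: n => // m m1; rewrite -sum_peak // -card_labeled_cycles //.
rewrite -sum1_card (partition_big (fun x => x.1) (@cyclicp m.+1)) /=; last first.
  by move=> x; rewrite inE => /andP[].
transitivity (\sum_(pi : 'S_m.+1 | cyclicp pi) ((in_pattern sigma5 (oneline pi)) * 2 +
   (in_pattern [:: true; false] (oneline pi)) * (2 * (peak pi).+1))).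
  apply: eq_bigr => pi cyc; rewrite -card_labelings_cyclic // -sum1_card.
  rewrite (reindex_onto (fun l => (pi, l)) (fun x => x.2)) /=.
    by apply: eq_bigl => l; rewrite !inE /= cyc !eqxx !andbT.
  by move=> [a b] /andP[_ /eqP /= ->].
rewrite big_split; congr addn.
  rewrite /c5 mulnC -sum_nat_const big_mkcond [RHS]big_mkcond; apply: eq_bigr => pi _.
  by rewrite inE; case: (cyclicp _); case: (in_pattern _ _).
rewrite [RHS]big_distrr big_mkcond [RHS]big_mkcond; apply: eq_bigr => pi _.
by rewrite inE; case: (cyclicp _); case: (in_pattern _ _); rewrite ?mul1n ?mul0n.
Qed.

Import GRing.Theory.
Local Open Scope ring_scope.

Theorem theorem4p5 (n : nat) (hn : (3 <= n)%N) :
  (c5 n)%:R = (Lstar 3 n sigma5)%:R / 2 - \sum_(2 <= i < n) (i * Lambda n i)%:R :> rat.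
Proof.
rewrite Lstar_sigma5 // -mulnDr natrM mulrAC mulfV // mul1r natrD.
by rewrite (natr_sum _ (index_iota 2 n)) addrK.
Qed.
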